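(* For RandomShuffle with constant step size, no choice of step size (given knowledge of $\mu,L,G$) leads to a convergence rate $o(1/T)$ valid for all $T\ge n$, if the bound is not allowed to depend on $n$. Precisely: there do not exist a step-size rule $\gamma=\gamma(T,n,\mu,L,G,D)\in\mathbb{R}$ and a function $r(T)=r(T;\mu,L,G,D)$, independent of $n$, with $T\,r(T;\mu,L,G,D)\to0$ as $T\to\infty$ for each fixed $(\mu,L,G,D)$, such that $$\mathbb{E}\big[\|x_T-x^*\|^2\big]\le r(T;\mu,L,G,D)$$ holds for all $\mu,L,G,D>0$, all $n\ge1$, all $d\ge1$, all multiples $T\ge n$ of $n$, all problems $F=\frac1n\sum_{i=1}^nf_i$ on $\mathbb{R}^d$ in the class with constants $(\mu,L,G,D)$ described in the context, and all initial points $x_0$ with $\|x_0-x^*\|\le D$, where $x_T$ is the output of RandomShuffle run for $T$ iterations from $x_0$ with constant step size $\gamma(T,n,\mu,L,G,D)$.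
   Context: Norms are Euclidean. Problem class with constants $(\mu,L,G,D)$: each $f_i:\mathbb{R}^d\to\mathbb{R}$ is convex, twice differentiable with Lipschitz continuous Hessian, and $L$-smooth ($\|\nabla f_i(x)-\nabla f_i(y)\|\le L\|x-y\|$); $F=\frac1n\sum_i f_i$ is $\mu$-strongly convex ($F(x)\ge F(y)+\langle\nabla F(y),x-y\rangle+\frac\mu2\|x-y\|^2$) with unique minimizer $x^*$; and $\|\nabla f_i(x)\|\le G$ for all $i$ and all $x$ with $\|x-x^*\|\le D$. RandomShuffle with constant step size $\gamma$, run for $T=ln$ iterations ($l$ a positive integer, the number of epochs) from $x_0$: set $x^1_0=x_0$. In each epoch $t=1,\dots,l$ draw a permutation $\sigma_t$ of $\{1,\dots,n\}$ uniformly at random, independently across epochs, and for $k=1,\dots,n$ set $x^t_k=x^t_{k-1}-\gamma\nabla f_{\sigma_t(k)}(x^t_{k-1})$; then put $x^{t+1}_0=x^t_n$. The output is $x_T=x^l_n$. Expectation is over the permutations. ''Constant step size'' means the same $\gamma$ is used in all $T$ iterations of a run (it may depend on $T$ and the problem constants). *)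

(* Defs.v *)
From HB Require Import structures.
From mathcomp Require Import all_boot all_order all_algebra all_fingroup.
From mathcomp Require Import all_classical all_reals all_analysis.

Set Implicit Arguments.
Unset Strict Implicit.
Unset Printing Implicit Defensive.

Import Order.TTheory GRing.Theory Num.Theory.
Import numFieldNormedType.Exports.

Local Open Scope classical_set_scope.
Local Open Scope ring_scope.

Section Euclidean.
Context {R : realType} {d : nat}.
Implicit Types (f : 'rV[R]_d -> R) (x y v : 'rV[R]_d).

Definition dotp x y : R := \sum_(j < d) x 0 j * y 0 j.

(* The library norm `|x| on 'rV[R]_d is the sup norm; enorm is the Euclidean one. *)
Definition enorm x : R := Num.sqrt (dotp x x).

Definition grad f x : 'rV[R]_d :=
  \row_(j < d) 'D_(delta_mx 0 j) (f : 'rV[R]_d -> R^o) x.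

Definition hessian f x : 'M[R]_d := 'J (grad f) x.

Definition twice_differentiable f :=
  (forall x, differentiable (f : 'rV[R]_d -> R^o) x) /\
  (forall x, differentiable (grad f) x).

(* Matrices are compared in the operator norm induced by enorm: the condition
   on all v says that the operator norm of hessian f x - hessian f y is at
   most M * enorm (x - y). *)
Definition lipschitz_hessian f :=
  exists M : R, forall x y v,
    enorm (v *m (hessian f x - hessian f y)) <= M * enorm (x - y) * enorm v.

Definition smooth (L : R) f :=
  forall x y, enorm (grad f x - grad f y) <= L * enorm (x - y).

Definition strongly_convex (mu : R) f :=
  forall x y,
    f y + dotp (grad f y) (x - y) + mu / 2 * enorm (x - y) ^+ 2 <= f x.

Definition unique_minimizer f x := forall y, y != x -> f x < f y.

End Euclidean.

Definition average {R : realType} {d n : nat} (f : 'I_n -> 'rV[R]_d -> R)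
    (x : 'rV[R]_d) : R :=
  n%:R^-1 * \sum_(i < n) f i x.

Record problem_class {R : realType} {d n : nat} (mu L G D : R)
    (f : 'I_n -> 'rV[R]_d -> R) (xstar : 'rV[R]_d) : Prop := ProblemClass {
  pc_convex : forall i, convex_function [set: 'rV[R]_d] (f i);
  pc_diff : forall i, twice_differentiable (f i);
  pc_hessian : forall i, lipschitz_hessian (f i);
  pc_smooth : forall i, smooth L (f i);
  pc_strong : strongly_convex mu (average f);
  pc_min : unique_minimizer (average f) xstar;
  pc_grad : forall i x, enorm (x - xstar) <= D -> enorm (grad (f i) x) <= G }.

Section RandomShuffle.
Context {R : realType} {d n : nat}.
Variables (gamma : R) (f : 'I_n -> 'rV[R]_d -> R).

Definition epoch (x : 'rV[R]_d) (s : 'S_n) : 'rV[R]_d :=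
  foldl (fun y (k : 'I_n) => y - gamma *: grad (f (s k)) y) x (enum 'I_n).

Definition random_shuffle (l : nat) (sigma : {ffun 'I_l -> 'S_n})
    (x0 : 'rV[R]_d) : 'rV[R]_d :=
  foldl (fun x (t : 'I_l) => epoch x (sigma t)) x0 (enum 'I_l).

End RandomShuffle.

(* Expectation under the uniform law on Omega. For Omega = {ffun 'I_l -> 'S_n}
   this law makes the l permutations independent and uniform on 'S_n. *)
Definition uniform_expectation {R : realType} (Omega : finType)
    (X : Omega -> R) : R :=
  #|Omega|%:R^-1 * \sum_(w : Omega) X w.

(* Main.v *)
Require Import Defs.
From HB Require Import structures.
From mathcomp Require Import all_boot all_order all_algebra all_fingroup.
From mathcomp Require Import all_classical all_reals all_analysis.
From mathcomp Require Import ring lra.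

Set Implicit Arguments.
Unset Strict Implicit.
Unset Printing Implicit Defensive.

Import Order.TTheory GRing.Theory Num.Theory.
Import numFieldNormedType.Exports.

Local Open Scope classical_set_scope.
Local Open Scope ring_scope.

(** The rate fails already for a single epoch ([l = 1], so [T = n]) on the
    line, with the parabolas [f_i x = x^2/2 - b_i x], where the [b_i] are the
    signs [(-1)^i] and [n] is a multiple of 16.  All the constants are fixed
    ([mu = L = D = 1], [G = 2]) and the average is [x^2/2], with minimizer [0].

    With step size [g] and [q = 1 - g], the epoch started at [1] ends at the
    affine form [q^n + g \sum_k q^(n-1-k) b_(sigma k)] in the shuffled signs.
    The signs sum to zero, so two entries of the shuffle have covariance
    [-1/(n-1)], and the mean square of the endpoint is exactly
      [q^(2n) + g^2/(n-1) (n \sum_k q^(2k) - (\sum_k q^k)^2)]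
    ([expectation_perm_sq], [expectation_parabolas]).

    No [g] makes this smaller than a constant over [n] ([epoch_error_ge]).
    A step [g <= 8/n] forgets the starting point too slowly: by Bernoulli's
    inequality [q^(2n)] is at least the constant [2^-32].  If [g > 8/n] and the
    bias [q^(2n)] is below [1/n], then [|q| < 1] and the geometric sums give
    [g^2 \sum_k q^(2k) = g (1 - q^(2n)) / (2 - g)], which exceeds
    [15/(4n)], while [(g \sum_k q^k)^2 = (1 - q^n)^2 <= 25/16]; hence the
    variance term exceeds [1/n].  Negative steps and steps [g >= 2] are covered
    by the same dichotomy.

    Thus [T r(T) >= 2^-32] along the multiples [T] of 16, which contradicts
    [T r(T) --> 0]. *)

(** * Expectation under a uniform law *)

Section UniformExpectation.
Context {R : realType}.

Lemma expectationD (Omega : finType) (X Y : Omega -> R) :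
  uniform_expectation (fun w => X w + Y w) =
  uniform_expectation X + uniform_expectation Y.
Proof. by rewrite /uniform_expectation big_split mulrDr. Qed.

Lemma expectationZ (Omega : finType) (c : R) (X : Omega -> R) :
  uniform_expectation (fun w => c * X w) = c * uniform_expectation X.
Proof. by rewrite /uniform_expectation -mulr_sumr mulrCA. Qed.

Lemma expectation_sum (Omega I : finType) (X : I -> Omega -> R) :
  uniform_expectation (fun w => \sum_i X i w) =
  \sum_i uniform_expectation (X i).
Proof. by rewrite /uniform_expectation exchange_big mulr_sumr. Qed.

Lemma expectation_cst (Omega : finType) (w0 : Omega) (c : R) :
  uniform_expectation (fun _ : Omega => c) = c.
Proof.
rewrite /uniform_expectation sumr_const -[c in X in _ * X]mulr1 -mulrnAr mulrCA.
rewrite mulVf ?mulr1// pnatr_eq0 -lt0n; by apply/card_gt0P; exists w0.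
Qed.

Lemma expectation_ext (Omega : finType) (X Y : Omega -> R) :
  X =1 Y -> uniform_expectation X = uniform_expectation Y.
Proof. by move=> XY; congr uniform_expectation; apply/funext. Qed.

(** A run of one epoch draws a single permutation, so the law on the sequences
    of length one is the uniform law on permutations. *)
Lemma expectation_ffun1 (Omega : finType) (X : Omega -> R) :
  uniform_expectation (fun sigma : {ffun 'I_1 -> Omega} => X (sigma ord0)) =
  uniform_expectation X.
Proof.
rewrite /uniform_expectation card_ffun card_ord expn1; congr (_ * _).
rewrite (reindex (fun w : Omega => [ffun _ : 'I_1 => w])) /=.
  by apply: eq_bigr => w _; rewrite ffunE.
exists (fun sigma : {ffun 'I_1 -> Omega} => sigma ord0) => [w _|sigma _].
  by rewrite ffunE.
by apply/ffunP => i; rewrite ffunE (ord1 i).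
Qed.

End UniformExpectation.

(** * Moments of a random permutation *)

Section RandomPermutation.
Context {R : realType} {T : finType}.
Local Notation n := (#|T|%:R : R).

Lemma expectation_permMl (s0 : {perm T}) (X : {perm T} -> R) :
  uniform_expectation (fun s => X (s0 * s)%g) = uniform_expectation X.
Proof.
rewrite /uniform_expectation; congr (_ * _).
by rewrite [RHS](reindex_inj (mulgI s0)).
Qed.

(** The expectation does not depend on [k], by composing with a transposition;
    averaged over all [k] the sum is the same for every permutation. *)
Lemma expectation_perm1 (F : T -> R) (k : T) :
  uniform_expectation (fun s : {perm T} => F (s k)) = n^-1 * \sum_i F i.
Proof.
have n0 : n != 0 by rewrite pnatr_eq0 -lt0n; apply/card_gt0P; exists k.
apply: (mulfI n0); rewrite mulVKf//.
transitivity (\sum_j uniform_expectation (fun s : {perm T} => F (s j))).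
  rewrite mulr_natl -sumr_const; apply: eq_bigr => j _.
  rewrite -[RHS](expectation_permMl (tperm j k)).
  by apply: expectation_ext => s; rewrite permM tpermL.
rewrite -expectation_sum -[RHS](expectation_cst (1%g : {perm T})).
by apply: expectation_ext => s; rewrite [RHS](reindex_inj (@perm_inj _ s)).
Qed.

(** Sampling without replacement from a centred population is negatively
    correlated: the entries of a shuffle sum to zero, so the covariances of
    [b (s j)] with all the others add up to minus its variance, and they are
    equal to each other by symmetry. *)
Lemma expectation_perm2 (b : T -> R) (j k : T) :
  \sum_i b i = 0 -> j != k ->
  (n - 1) * uniform_expectation (fun s : {perm T} => b (s j) * b (s k)) =
  - (n^-1 * \sum_i b i ^+ 2).
Proof.
move=> b0 jk.
pose P i := uniform_expectation (fun s : {perm T} => b (s j) * b (s i)).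
have Pk i : i != j -> P i = P k.
  move=> ij; rewrite /P -[RHS](expectation_permMl (tperm k i)).
  apply: expectation_ext => s; rewrite !permM tpermL tpermD//.
  by rewrite eq_sym.
have sumP : \sum_i P i = 0.
  rewrite -expectation_sum -[RHS](expectation_cst (1%g : {perm T})).
  apply: expectation_ext => s; rewrite -mulr_sumr.
  have -> : \sum_i b (s i) = 0.
    by rewrite -[RHS]b0 [RHS](reindex_inj (@perm_inj _ s)).
  by rewrite mulr0.
have Pj : P j = n^-1 * \sum_i b i ^+ 2.
  rewrite -(expectation_perm1 (fun i => b i ^+ 2) j).
  by apply: expectation_ext => s; rewrite expr2.
have : P j + \sum_(i | i != j) P i = 0 by rewrite -[RHS]sumP [RHS](bigD1 j).
rewrite (eq_bigr _ Pk) (eq_bigl [in predC1 j])// sumr_const cardC1.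
rewrite -Pj -/(P k).
have n0 : (0 < #|T|)%N by apply/card_gt0P; exists k.
have -> : n - 1 = #|T|.-1%:R by rewrite -subn1 natrB.
by rewrite -[P k *+ _]mulr_natl addrC => /eqP; rewrite addr_eq0 => /eqP.
Qed.

(** The last factor is [n] times the sum of the squared deviations of the
    weights from their mean: a constant weight contributes nothing, since the
    entries of the shuffle sum to zero. *)
Lemma expectation_perm_sq (a : R) (b w : T -> R) :
  (1 < #|T|)%N -> \sum_i b i = 0 ->
  uniform_expectation (fun s : {perm T} => (a + \sum_k w k * b (s k)) ^+ 2) =
  a ^+ 2 + (\sum_i b i ^+ 2) / (n * (n - 1))
           * (n * \sum_k w k ^+ 2 - (\sum_k w k) ^+ 2).
Proof.
move=> n1 b0; set B := \sum_i _ ^+ 2.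
have n0 : n != 0 by rewrite pnatr_eq0 -lt0n ltnW.
have n10 : n - 1 != 0 by rewrite subr_eq0 (eqr_nat R _ 1) gtn_eqF.
pose X j k (s : {perm T}) := w j * w k * (b (s j) * b (s k)).
transitivity (a ^+ 2 + uniform_expectation
    (fun s : {perm T} => \sum_j 2 * a * w j * b (s j))
  + uniform_expectation (fun s => \sum_j \sum_k X j k s)).
  rewrite -(expectation_cst (1%g : {perm T}) (a ^+ 2)) -!expectationD.
  apply: expectation_ext => s; rewrite sqrrD; congr (_ + _ + _).
    rewrite -mulrnAl -mulr_natl mulr_sumr.
    by apply: eq_bigr => j _; rewrite mulrA.
  rewrite expr2 mulr_suml; apply: eq_bigr => j _.
  by rewrite mulr_sumr; apply: eq_bigr => k _; rewrite /X mulrACA.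
rewrite expectation_sum big1 ?addr0 => [|j _]; last first.
  rewrite (expectationZ _ (fun s : {perm T} => b (s j))).
  by rewrite (expectation_perm1 b) b0 !mulr0.
congr (_ + _); rewrite expectation_sum.
(* The covariance is the constant [- B / (n (n - 1))] off the diagonal; on it,
   the variance [B / n] differs from this constant by [B / (n - 1)]. *)
have EX j k : uniform_expectation (X j k) =
    B / (n - 1) * (w j * w k * (j == k)%:R) - B / (n * (n - 1)) * (w j * w k).
  rewrite (expectationZ _ (fun s : {perm T} => b (s j) * b (s k))).
  have [<-|jk] := eqVneq j k.
    rewrite (expectation_ext (Y := fun s : {perm T} => b (s j) ^+ 2));
      last by move=> s; rewrite expr2.
    rewrite (expectation_perm1 (fun i => b i ^+ 2)) -/B /= mulr1n.
    by field; apply/andP.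
  apply: (mulfI n10); rewrite mulrCA expectation_perm2// -/B /= mulr0n.
  by field; apply/andP.
transitivity (\sum_j (B / (n - 1) * w j ^+ 2
                      - B / (n * (n - 1)) * (w j * \sum_k w k))).
  apply: eq_bigr => j _; rewrite expectation_sum (eq_bigr _ (fun k _ => EX j k)).
  rewrite sumrB -!mulr_sumr; congr (_ * _ - _).
  rewrite (bigD1 j)//= eqxx big1 ?addr0 ?mulr1 ?expr2// => k kj.
  by rewrite eq_sym (negbTE kj) mulr0.
rewrite sumrB -!mulr_sumr -mulr_suml; field; exact/andP.
Qed.

End RandomPermutation.

(** * One epoch cannot beat the rate 1/n *)

Lemma foldl_affine (R : comPzRingType) (q : R) n (c : 'I_n -> R) (y : R) :
  foldl (fun y k => q * y + c k) y (enum 'I_n) =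
  q ^+ n * y + \sum_(k < n) q ^+ (n - k.+1) * c k.
Proof.
elim: n c => [|n IHn] c.
  by rewrite big_ord0 enum_ord0 /= expr0 mul1r addr0.
have foldl_map A B C (h : A -> B) (g : C -> B -> C) z s :
    foldl g z (map h s) = foldl (fun y i => g y (h i)) z s.
  by elim: s z => //= i s IHs z.
rewrite enum_ordSr foldl_rcons foldl_map IHn big_ord_recr /= subnn mul1r addrA.
congr (_ + _); rewrite mulrDr mulrA -exprS mulr_sumr; congr (_ + _).
by apply: eq_bigr => k _; rewrite mulrA -exprS subSS -subSn.
Qed.

Lemma bernoulli_ineq (R : realDomainType) (x : R) m :
  -1 <= x -> 1 + m%:R * x <= (1 + x) ^+ m.
Proof.
move=> x1; elim: m => [|m IHm]; first by rewrite mul0r addr0 expr0.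
rewrite exprS -natr1; have x0 : 0 <= 1 + x by lra.
have := ler_wpM2l x0 IHm; have := mulr_ge0 (ler0n R m) (sqr_ge0 x); nra.
Qed.

Lemma alternating_sum_eq0 (R : realDomainType) n :
  ~~ odd n -> \sum_(k < n) (-1) ^+ k = 0 :> R.
Proof.
move=> n2; have := subrX1 (-1 : R) n.
rewrite -signr_odd (negbTE n2) expr0 subrr => /esym/eqP.
by rewrite mulf_eq0 => /orP[/eqP|/eqP//]; lra.
Qed.

Lemma sqr_sum_le (R : realFieldType) n (w : 'I_n -> R) :
  (\sum_k w k) ^+ 2 <= n%:R * \sum_k w k ^+ 2.
Proof.
case: n w => [|n] w; first by rewrite !big_ord0 mul0r expr0n.
set S := \sum_k w k; set N : R := n.+1%:R.
have N0 : 0 < N by rewrite ltr0n.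
have : 0 <= \sum_k (N * w k - S) ^+ 2 by apply: sumr_ge0 => k _; exact: sqr_ge0.
have -> : \sum_k (N * w k - S) ^+ 2 = N * (N * \sum_k w k ^+ 2 - S ^+ 2).
  transitivity (\sum_k (N ^+ 2 * w k ^+ 2 - 2 * N * S * w k + S ^+ 2)).
    by apply: eq_bigr => k _; ring.
  rewrite big_split /= sumrB -!mulr_sumr sumr_const card_ord -/S.
  rewrite -[S *+ _]mulr_natl -/N.
  by ring.
by rewrite pmulr_rge0// subr_ge0.
Qed.

(** The starting point and the gradient noise cannot both be damped below
    [1/n].  The factor 16 in [n] lets Bernoulli's inequality be applied with the
    integer exponent [m = n/16], for which [8/n] is half of [1/m]. *)
Lemma epoch_error_ge (R : realFieldType) (g : R) (m : nat) (n := (16 * m)%N) :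
  (0 < m)%N ->
  2 ^- 32 <= n%:R * (((1 - g) ^+ n) ^+ 2 + g ^+ 2 / (n%:R - 1) *
    (n%:R * \sum_(k < n) ((1 - g) ^+ k) ^+ 2
     - (\sum_(k < n) (1 - g) ^+ k) ^+ 2)).
Proof.
move=> m0; set q := 1 - g; set u := q ^+ n; set N : R := n%:R.
set S2 := \sum_(k < n) _; set S1 := \sum_(k < n) _.
have NE : N = 16 * m%:R by rewrite /N /n natrM.
have m1 : 1 <= m%:R :> R by rewrite ler1n.
have c1 : 2 ^- 32 <= 1 :> R by rewrite invf_le1 ?exprn_gt0// exprn_ege1// ler1n.
have V0 : 0 <= N * S2 - S1 ^+ 2 by rewrite subr_ge0 sqr_sum_le.
have N1 : 0 < N - 1 by lra.
have C0 : 0 <= g ^+ 2 / (N - 1) by rewrite divr_ge0 ?sqr_ge0// ltW.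
have CV0 := mulr_ge0 C0 V0.
(* For [g <= 8/n], [q^m >= 1/2], hence [q^(2n) = (q^m)^32 >= 2^-32]. *)
have [gle|ggt] := leP (g * N) 8.
  have qge : 1 + - (2 * m%:R)^-1 <= q.
    rewrite lerD2l lerN2 -(ler_pM2r (_ : 0 < N)); last lra.
    by apply: le_trans gle _; rewrite NE (_ : _ * _ = 8)//; field; lra.
  have i0 : (2 * m%:R)^-1 <= 1 :> R by rewrite invf_le1; lra.
  have qm : 2^-1 <= q ^+ m.
    apply: le_trans (_ : (1 - (2 * m%:R)^-1) ^+ m <= _); last first.
      by apply: lerXn2r; rewrite ?nnegrE; lra.
    apply: le_trans (bernoulli_ineq _ _); last lra.
    by rewrite (_ : _ + _ = 2^-1)//; field; lra.
  have uE : u ^+ 2 = (q ^+ m) ^+ 32.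
    by rewrite /u -!exprM /n mulnAC mulnC.
  have u2 : 2 ^- 32 <= u ^+ 2.
    by rewrite uE -exprVn; apply: lerXn2r; rewrite ?nnegrE; lra.
  apply: le_trans u2 _; have := sqr_ge0 u; nra.
(* If the bias [u^2] is at least [1/n], nothing more is needed; otherwise
   [|q| < 1] and the geometric sums are controlled by [u]. *)
have [ule|ugt] := leP 1 (N * u ^+ 2).
  by rewrite mulrDr; have := mulr_ge0 (ltW (_ : 0 < N)) CV0; lra.
(* For [g >= 2] the iteration is not contracting: [|q| >= 1]. *)
have g2 : g < 2.
  rewrite ltNge; apply/negP => g2; move: ugt; rewrite ltNge => /negP; apply.
  have : 1 <= u ^+ 2.
    rewrite /u -exprM mulnC exprM exprn_ege1//; rewrite /q; nra.
  nra.
have g0 : 0 < g by nra.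
have gS1 : g * S1 = 1 - u.
  by have := subrX1 q n; rewrite -/u -/S1 (_ : q - 1 = - g); [lra|rewrite /q; ring].
have gS2 : g * (2 - g) * S2 = 1 - u ^+ 2.
  have := subrX1 (q ^+ 2) n; rewrite -exprM mulnC exprM -/u.
  under eq_bigr do rewrite exprAC.
  by rewrite -/S2 => e; rewrite -[RHS]opprB e /q; ring.
have u16 : u ^+ 2 <= 16^-1 by have := sqr_ge0 u; nra.
have uge : - 4^-1 <= u by nra.
set X := g ^+ 2 * S2.
have XE : X * (2 - g) = g * (1 - u ^+ 2) by rewrite -gS2 /X; ring.
have X0 : 0 <= X.
  by rewrite -(pmulr_lge0 _ (_ : 0 < 2 - g)) ?XE ?mulr_ge0//; lra.
have Xge : g * (1 - u ^+ 2) <= 2 * X by rewrite -XE; nra.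
have NX : 15 / 4 <= N * X by nra.
have W : 1 <= g ^+ 2 * (N * S2 - S1 ^+ 2).
  have -> : g ^+ 2 * (N * S2 - S1 ^+ 2) = N * X - (1 - u) ^+ 2.
    by rewrite -gS1 /X; ring.
  nra.
apply: (le_trans c1); rewrite mulrDr.
apply: le_trans (_ : N * (g ^+ 2 / (N - 1) * (N * S2 - S1 ^+ 2)) <= _); last first.
  by rewrite lerDr mulr_ge0// ?sqr_ge0//; lra.
rewrite mulrAC mulrA ler_pdivlMr// mul1r; nra.
Qed.

(** * Tilted parabolas on the line *)

Section Dimension1.
Context {R : realType}.
Implicit Types x y v : 'rV[R]_1.

Lemma enorm1 x : enorm x = `|x 0 0|.
Proof. by rewrite /enorm /dotp big_ord1 -expr2 sqrtr_sqr. Qed.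

Definition tilted_parabola (b : R) x : R := 2^-1 * x 0 0 ^+ 2 - b * x 0 0.

Lemma diff_tilted_parabola b x :
  is_diff x (tilted_parabola b : 'rV[R]_1 -> R^o) (fun v => (x 0 0 - b) * v 0 0).
Proof.
have dc : is_diff x (fun y => y 0 0 : R^o) (fun v => v 0 0).
  have lc : linear (fun y : 'rV[R]_1 => y 0 0 : R^o).
    by move=> a y z; rewrite !mxE.
  pose C := GRing.isLinear.Build _ _ _ _ _ lc.
  pose c : {linear 'rV[R]_1 -> R^o} := HB.pack (fun y : 'rV[R]_1 => y 0 0 : R^o) C.
  have cc : continuous c by exact: coord_continuous.
  apply: DiffDef; first exact: differentiable_coord.
  exact: (diff_lin x cc).
have := is_diffB (is_diffZ 2^-1 (is_diffX 1 dc)) (is_diffZ b dc).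
set h := (X in is_diff _ X _); set dh := (X in is_diff _ _ X) => H.
have -> : (tilted_parabola b : 'rV[R]_1 -> R^o) = h.
  by apply/funext => y; rewrite /h /tilted_parabola.
have -> : (fun v => (x 0 0 - b) * v 0 0) = dh.
  apply/funext => v; rewrite /dh /=.
  rewrite (_ : (_ : 'rV[R]_1 -> R^o) v = 2^-1 * (2 * x 0 0 ^+ 1 * v 0 0) - b * v 0 0)//.
  by rewrite expr1; field.
exact: H.
Qed.

Lemma grad_tilted_parabola b x : grad (tilted_parabola b) x = x - const_mx b.
Proof.
apply/rowP => j; rewrite !mxE deriveE; last first.
  exact: (@ex_diff _ _ _ _ _ _ _ (diff_tilted_parabola b x)).
by rewrite (@diff_val _ _ _ _ _ _ _ (diff_tilted_parabola b x)) (ord1 j) !mxE mulr1.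
Qed.

Lemma differentiable_shift (c : 'rV[R]_1) x : differentiable (fun y => y - c) x.
Proof. exact: differentiableB. Qed.

Lemma hessian_tilted_parabola b x : hessian (tilted_parabola b) x = 1%:M.
Proof.
rewrite /hessian (funext (grad_tilted_parabola b)) /jacobian.
apply/row_matrixP => i; rewrite !rowE mul_rV_lin1 mulmx1.
have H := is_diffB (is_diff_id x) (is_diff_cst (const_mx b : 'rV[R]_1) x).
by rewrite (@diff_val _ _ _ _ _ _ _ H) /= subr0.
Qed.

Lemma convex_tilted_parabola b :
  convex_function [set: 'rV[R]_1] (tilted_parabola b).
Proof.
move=> t x y _ _; rewrite convRE /tilted_parabola.
have -> : (conv t (x : convex_lmodType 'rV[R]_1) y) 0 0 = t%:inum * x 0 0 + (1 - t%:inum) * y 0 0.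
  by rewrite /conv /= !mxE.
have t0 : 0 <= t%:inum by [].
have t1 : t%:inum <= 1 by [].
set u := t%:inum in t0 t1 *.
have t1' : 0 <= 1 - u by rewrite subr_ge0.
have := mulr_ge0 (mulr_ge0 t0 t1') (sqr_ge0 (x 0 0 - y 0 0)).
by rewrite /unstable.onem; lra.
Qed.

(** The tilts average out, so the average is the parabola [x^2/2]; the gradient
    bound is 2 because [|x - b_i| <= 1 + 1] on the unit ball. *)
Lemma problem_class_parabolas n (b : 'I_n -> R) :
  (0 < n)%N -> (forall i, `|b i| <= 1) -> \sum_i b i = 0 ->
  problem_class 1 1 2 1 (fun i => tilted_parabola (b i)) (0 : 'rV[R]_1).
Proof.
move=> n0 b1 b0.
have aE : average (fun i => tilted_parabola (b i)) = tilted_parabola 0.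
  apply/funext => x; rewrite /average /tilted_parabola sumrB -[X in _ - X]mulr_suml b0.
  rewrite sumr_const card_ord mul0r !subr0 -(mulr_natl (_ * _)) mulKf//.
  by rewrite pnatr_eq0 -lt0n.
split.
- by move=> i; exact: convex_tilted_parabola.
- move=> i; split=> x; first exact: (@ex_diff _ _ _ _ _ _ _ (diff_tilted_parabola (b i) x)).
  by rewrite (funext (grad_tilted_parabola (b i))); exact: differentiable_shift.
- move=> i; exists 0 => x y v.
  by rewrite !hessian_tilted_parabola subrr mulmx0 !mul0r enorm1 mxE normr0.
- by move=> i x y; rewrite !grad_tilted_parabola opprB addrA subrK mul1r.
- move=> x y; rewrite aE grad_tilted_parabola enorm1 real_normK ?num_real//.
  rewrite /dotp big_ord1 /tilted_parabola !mxE; lra.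
- move=> y y0; rewrite aE /tilted_parabola mxE expr0n mulr0 !mul0r !subr0.
  rewrite mulr_gt0// exprn_even_gt0//=; apply: contra_neq y0 => y0.
  by apply/rowP => j; rewrite (ord1 j) y0 mxE.
- move=> i x; rewrite subr0 grad_tilted_parabola !enorm1 !mxE => x1.
  by apply: le_trans (ler_normB _ _) _; have := b1 i; lra.
Qed.

Lemma random_shuffle_parabolas n (b : 'I_n -> R) (g : R)
    (sigma : {ffun 'I_1 -> 'S_n}) (x0 : 'rV[R]_1) :
  (random_shuffle g (fun i => tilted_parabola (b i)) sigma x0) 0 0 =
  (1 - g) ^+ n * x0 0 0
  + \sum_(k < n) g * (1 - g) ^+ (n - k.+1) * b (sigma ord0 k).
Proof.
rewrite /random_shuffle enum_ordSl /= enum_ord0 /= /epoch.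
transitivity (foldl (fun (z : R) k => (1 - g) * z + g * b (sigma ord0 k))
                    (x0 0 0) (enum 'I_n)).
  elim: (enum 'I_n) x0 => //= k s IHs x0; rewrite IHs; congr foldl.
  by rewrite grad_tilted_parabola !mxE; ring.
rewrite foldl_affine; congr (_ + _).
by apply: eq_bigr => k _; ring.
Qed.

(** Mean squared error after one epoch from the point 1; the two summands are
    the squared bias and the variance. *)
Lemma expectation_parabolas n (b : 'I_n -> R) (g : R) :
  (1 < n)%N -> \sum_i b i = 0 -> (forall i, b i ^+ 2 = 1) ->
  uniform_expectation (fun sigma : {ffun 'I_1 -> 'S_n} =>
    enorm (random_shuffle g (fun i => tilted_parabola (b i)) sigma (const_mx 1)
           - 0) ^+ 2) =
  ((1 - g) ^+ n) ^+ 2 + g ^+ 2 / (n%:R - 1) *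
    (n%:R * \sum_(k < n) ((1 - g) ^+ k) ^+ 2
     - (\sum_(k < n) (1 - g) ^+ k) ^+ 2).
Proof.
move=> n1 b0 b2.
pose X (s : 'S_n) := ((1 - g) ^+ n
   + \sum_(k < n) g * (1 - g) ^+ (n - k.+1) * b (s k)) ^+ 2.
rewrite (expectation_ext (Y := fun sigma : {ffun 'I_1 -> 'S_n} => X (sigma ord0)));
  last first.
  move=> sigma; rewrite subr0 enorm1 real_normK ?num_real//.
  by rewrite random_shuffle_parabolas mxE mulr1.
rewrite expectation_ffun1 expectation_perm_sq ?card_ord//; congr (_ + _).
rewrite (eq_bigr (fun=> 1)) // sumr_const card_ord -mulr_sumr.
under eq_bigr do rewrite exprMn.
rewrite -mulr_sumr.
have rev_sum (F : nat -> R) : \sum_(k < n) F (n - k.+1)%N = \sum_(k < n) F k.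
  by rewrite [RHS](reindex_inj rev_ord_inj).
rewrite (rev_sum (fun k => ((1 - g) ^+ k) ^+ 2)) (rev_sum (fun k => (1 - g) ^+ k)).
field.
have : 1 < n%:R :> R by rewrite ltr1n.
by move=> N1; apply/andP; split; lra.
Qed.

End Dimension1.

Theorem theorem3 (R : realType) :
  ~ exists (gamma : nat -> nat -> R -> R -> R -> R -> R)
           (r : nat -> R -> R -> R -> R -> R),
      (forall mu L G D : R, 0 < mu -> 0 < L -> 0 < G -> 0 < D ->
         (fun T : nat => T%:R * r T mu L G D) @ \oo --> (0 : R)) /\
      (forall (mu L G D : R), 0 < mu -> 0 < L -> 0 < G -> 0 < D ->
       forall (n d l : nat), (0 < n)%N -> (0 < d)%N -> (0 < l)%N ->
       forall (f : 'I_n -> 'rV[R]_d -> R) (xstar : 'rV[R]_d),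
         problem_class mu L G D f xstar ->
       forall x0 : 'rV[R]_d, enorm (x0 - xstar) <= D ->
         uniform_expectation
           (fun sigma : {ffun 'I_l -> 'S_n} =>
              enorm (random_shuffle (gamma (l * n)%N n mu L G D) f sigma x0
                     - xstar) ^+ 2)
         <= r (l * n)%N mu L G D).
Proof.
case=> gamma [r [/(_ 1 1 2 1 ltr01 ltr01 (ltr0Sn _ _) ltr01) r0 main]].
have c0 : 0 < 2 ^- 32 :> R by rewrite invr_gt0 exprn_gt0.
move/cvgrPdist_lt: r0 => /(_ _ c0) [N _ rN].
(* A size beyond the threshold [N] of the limit, in the form that
   [epoch_error_ge] requires. *)
pose n := (16 * N.+1)%N.
have Nn : (N <= n)%N by rewrite (leq_trans (leqnSn N))// leq_pmull.
have := rN n Nn; rewrite /= sub0r normrN.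
apply/negP; rewrite -leNgt; apply: le_trans (ler_norm _).
have n_gt1 : (1 < n)%N by rewrite /n mulnS.
pose b (i : 'I_n) : R := (-1) ^+ i.
have b0 : \sum_i b i = 0 by apply: alternating_sum_eq0; rewrite oddM.
have b2 i : b i ^+ 2 = 1 by rewrite sqrr_sign.
have b1 i : `|b i| <= 1 by rewrite normr_sign.
have x0D : enorm (const_mx 1 - 0 : 'rV[R]_1) <= 1.
  by rewrite subr0 enorm1 mxE normr1.
have := main 1 1 2 1 ltr01 ltr01 (ltr0Sn _ _) ltr01 n 1%N 1%N (ltnW n_gt1)
  isT isT _ _ (problem_class_parabolas (ltnW n_gt1) b1 b0) _ x0D.
rewrite expectation_parabolas// mul1n => Er.
by apply: le_trans (epoch_error_ge _ _) (ler_wpM2l (ler0n _ _) Er).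
Qed.
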